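(* Let $G$ be a finite group that is a central product of its subgroups $A$ and $B$. Then $$m^*(G) = \frac{m^*(A)\cdot m^*(B)}{|A\cap B|^2}.$$
   Context: A group $G$ is a central product of its subgroups $A$ and $B$ if $G = AB$ and $[A,B]=1$ (i.e. $ab=ba$ for all $a\in A$, $b\in B$). For a finite group $G$ and $H \leq G$, the Chermak--Delgado measure is $m_G(H) = |H|\cdot|\mathbf{C}_G(H)|$, where $\mathbf{C}_G(H)$ is the centralizer of $H$ in $G$; $m^*(G)$ denotes the maximum of $m_G(H)$ over all subgroups $H \leq G$. The numbers $m^*(A)$ and $m^*(B)$ are defined in the same way with $A$, $B$ as ambient groups. *)

(* Defs.v *)
From mathcomp Require Import all_boot all_order all_algebra all_fingroup.
Set Implicit Arguments.
Unset Strict Implicit.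
Unset Printing Implicit Defensive.

Local Open Scope group_scope.

(* Intended for H a subgroup of G; the centralizer is taken inside the
   ambient group G. *)
Definition cd_measure (gT : finGroupType) (G H : {group gT}) : nat :=
  (#|H| * #|'C_G(H)|)%N.

(* The default value 0 of \max is harmless: the index set contains G. *)
Definition cd_max (gT : finGroupType) (G : {group gT}) : nat :=
  \max_(H : {group gT} | H \subset G) cd_measure G H.

(* Main.v *)
Require Import Defs.
From mathcomp Require Import all_boot all_order all_algebra all_fingroup.
Set Implicit Arguments.
Unset Strict Implicit.
Unset Printing Implicit Defensive.
Import GRing.Theory.
Local Open Scope ring_scope.

(** Write Z for the intersection of A and B; it is central in G, because A and B
    centralize each other.  The formula is proved as two inequalities between
    m*(G) |Z|^2 and m*(A) m*(B).

    Lower bound: let H <= A and K <= B attain m*(A) and m*(B).  Joining a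
    central subgroup to H leaves its centralizer unchanged and can only enlarge
    H, so both may be assumed to contain Z.  Then H and K, and likewise their
    centralizers in A and B, meet exactly in Z, and 'C_A(H) 'C_B(K) centralizes
    HK; the product formula for orders gives m_G(HK) |Z|^2 >= m_A(H) m_B(K).

    Upper bound: a subgroup H of G need not be a product of subgroups of A
    and B, and replacing it by the product of its two projections can shrink
    the centralizer, since the components of commuting elements commute only
    modulo Z.  The remedy is to intersect on one side and project on the other.
    The order of H is determined by its intersection with A and its projection
    to B (lemma card_cap_proj), and the order of 'C_G(H) by its projection to A
    and its intersection with B.  The projection of 'C_G(H) to A centralizes
    the intersection of H with A, because B centralizes A; symmetrically, the
    intersection of 'C_G(H) with B centralizes the projection of H to B.
    Hence m_G(H) |Z|^2 <= m_A(H :&: A) m_B(B :&: HA). *)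

Section CentralProduct.
Local Open Scope group_scope.

Variable gT : finGroupType.
Implicit Types G H K A B Z : {group gT}.

Lemma cd_measure_le_max G H : H \subset G -> (cd_measure G H <= cd_max G)%N.
Proof.
by move=> sHG; rewrite /cd_max (bigD1 H) //= leq_maxl.
Qed.

(** Joining a central subgroup Z to a maximizer H keeps it a maximizer, since
    'C_G(H) already centralizes Z. *)
Lemma cd_max_attained_over G Z :
    Z \subset G -> Z \subset 'C(G) ->
  exists H, [/\ H \subset G, Z \subset H & cd_max G = cd_measure G H].
Proof.
move=> sZG cGZ.
have: (0 < #|[pred H : {group gT} | H \subset G]|)%N.
  by apply/card_gt0P; exists G; rewrite inE.
case/(eq_bigmax_cond (cd_measure G)) => H; rewrite inE => sHG maxH.
have sHZG : H <*> Z \subset G by rewrite join_subG sHG.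
exists (H <*> Z)%G; split; rewrite ?joing_subr //.
apply/eqP; rewrite eqn_leq cd_measure_le_max // andbT /cd_max maxH leq_mul //.
  by rewrite subset_leq_card ?joing_subl.
rewrite subset_leq_card // subsetI subsetIl centY subsetI subsetIr.
by rewrite (subset_trans (subsetIl _ _)) // centsC.
Qed.

(** For normal A this is the order of H computed through the second isomorphism
    theorem: HA / A is isomorphic both to H / (H :&: A) and, as G = AB, to
    (B :&: HA) / (A :&: B). *)
Lemma card_cap_proj G A B H :
    A * B = G -> A <| G -> H \subset G ->
  (#|H| * #|A :&: B| = #|H :&: A| * #|B :&: (H <*> A)|)%N.
Proof.
move=> defG /andP[sAG nAG] sHG.
have defHA : H <*> A = H * A by rewrite norm_joinEl ?(subset_trans sHG).
have sAHA : A \subset H <*> A := joing_subr H A.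
have defHA2 : A * (B :&: (H <*> A)) = H * A.
  by rewrite group_modl // defG -defHA; apply/setIidPr; rewrite join_subG sHG.
have := mul_cardG A (B :&: (H <*> A))%G.
rewrite /= defHA2 [B :&: _]setIC setIA (setIidPl sAHA) => cardProj.
have cardHA := mul_cardG H A.
apply/eqP; rewrite -(eqn_pmul2l (cardG_gt0 A)); apply/eqP.
rewrite mulnA [(#|A| * _)%N]mulnC cardHA mulnAC -cardProj.
by rewrite -mulnA [(_ * #|H :&: A|)%N]mulnC.
Qed.

Lemma cd_max_cprod_ge G A B :
    A * B = G -> B \subset 'C(A) ->
  (cd_max A * cd_max B <= cd_max G * #|A :&: B| ^ 2)%N.
Proof.
move=> defG cAB; have cBA : A \subset 'C(B) by rewrite centsC.
have sZcA : A :&: B \subset 'C(A) := subset_trans (subsetIr A B) cAB.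
have sZcB : A :&: B \subset 'C(B) := subset_trans (subsetIl A B) cBA.
have [H [sHA sZH ->]] := cd_max_attained_over (subsetIl A B) sZcA.
have [K [sKB sZK ->]] := cd_max_attained_over (subsetIr A B) sZcB.
have cap (X Y : {set gT}) : X \subset A -> Y \subset B -> A :&: B \subset X ->
    A :&: B \subset Y -> X :&: Y = A :&: B.
  move=> sXA sYB sZX sZY; apply/eqP.
  by rewrite eqEsubset subsetI sZX sZY setISS.
have capHK : H :&: K = A :&: B by apply: cap.
have capC : 'C_A(H) :&: 'C_B(K) = A :&: B.
  apply: cap; rewrite ?subsetIl // subsetI ?subsetIl ?subsetIr /=.
    by rewrite (subset_trans (subsetIr _ _)) // (subset_trans cAB) ?centS.
  by rewrite (subset_trans (subsetIl _ _)) // (subset_trans cBA) ?centS.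
have defHK : H <*> K = H * K.
  by rewrite cent_joinEr // (subset_trans sKB) // (subset_trans cAB) ?centS.
have sHKG : H <*> K \subset G by rewrite defHK -defG mulgSS.
have sCC : 'C_A(H) * 'C_B(K) \subset 'C_G(H <*> K).
  rewrite subsetI -defG mulgSS ?subsetIl //= centY mul_subG // subsetI.
    rewrite subsetIr (subset_trans (subsetIl _ _)) //.
    by rewrite (subset_trans cBA) ?centS.
  rewrite subsetIr andbT (subset_trans (subsetIl _ _)) //.
  by rewrite (subset_trans cAB) ?centS.
apply: leq_trans (leq_mul (cd_measure_le_max sHKG) (leqnn _)).
rewrite /cd_measure mulnACA (mul_cardG H K) (mul_cardG 'C_A(H) 'C_B(K)).
rewrite capHK capC /= -defHK mulnACA mulnn.
by rewrite leq_mul ?leq_mul ?(subset_leq_card sCC).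
Qed.

Lemma cd_max_cprod_le G A B :
    A * B = G -> B \subset 'C(A) ->
  (cd_max G * #|A :&: B| ^ 2 <= cd_max A * cd_max B)%N.
Proof.
move=> defG cAB; have cBA : A \subset 'C(B) by rewrite centsC.
have defG' : B * A = G by rewrite -(centC cBA).
have [sAG sBG] : A \subset G /\ B \subset G.
  by rewrite -defG mulG_subl mulG_subr.
have nAG : A <| G.
  by rewrite /normal sAG -defG mul_subG ?normG // cents_norm.
have nBG : B <| G.
  by rewrite /normal sBG -defG mul_subG ?normG // cents_norm.
have [H [sHG _ ->]] := cd_max_attained_over (sub1G G) (sub1G 'C(G)).
have cardH := card_cap_proj defG nAG sHG.
have cardC := card_cap_proj defG' nBG (subsetIl G 'C(H)).
rewrite setIC /= in cardC.
have projC : A :&: ('C_G(H) <*> B) \subset 'C_A(H :&: A).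
  rewrite setIS // join_subG (subset_trans (subsetIr _ _)) ?centS ?subsetIl //=.
  by rewrite (subset_trans cAB) ?centS ?subsetIr.
have capC : 'C_G(H) :&: B \subset 'C_B(B :&: (H <*> A)).
  rewrite [_ :&: B]setIC subsetI subsetIl /=.
  apply: subset_trans (centS (subsetIr _ _)).
  rewrite centY subsetI (subset_trans (subsetIl _ _) cAB) andbT.
  by rewrite (subset_trans (subsetIr _ _)) // subsetIr.
rewrite /cd_measure -mulnn mulnACA cardH cardC.
rewrite [(#|'C_G(H) :&: B| * _)%N]mulnC mulnACA.
apply: leq_mul.
  apply: leq_trans (cd_measure_le_max (subsetIr H A)).
  by rewrite leq_mul2l subset_leq_card ?orbT.
apply: leq_trans (cd_measure_le_max (subsetIl B (H <*> A))).
by rewrite leq_mul2l subset_leq_card ?orbT.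
Qed.

End CentralProduct.

Theorem corollary1 (gT : finGroupType) (G A B : {group gT})
  (defG : (A \* B)%g = G) :
  (cd_max G)%:R
    = (cd_max A)%:R * (cd_max B)%:R / #|(A :&: B)%g|%:R ^+ 2 :> rat.
Proof.
have [_ defAB cAB] := cprodP defG.
have cd_maxE : (cd_max G * #|(A :&: B)%g| ^ 2 = cd_max A * cd_max B)%N.
  by apply/eqP; rewrite eqn_leq cd_max_cprod_le ?cd_max_cprod_ge.
rewrite -natrM -cd_maxE natrM natrX mulfK // expf_neq0 //.
by rewrite Num.Theory.pnatr_eq0 -lt0n cardG_gt0.
Qed.
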